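(* Let $\mathcal G_1$ and $\mathcal G_2$ be monotone graph classes each containing $K_2$. Then $\operatorname{tw}(\mathcal G_1\times\mathcal G_2)$ is bounded if and only if $\operatorname{tw}(\mathcal G_1)$ and $\operatorname{tw}(\mathcal G_2)$ are bounded and at least one of the following holds: (i) $\tilde{\mathsf v}(\mathcal G_1)$ or $\tilde{\mathsf v}(\mathcal G_2)$ is bounded; (ii) $\tilde\tau(\mathcal G_1)$ and $\Delta(\mathcal G_2)$ are bounded; (iii) $\tilde\tau(\mathcal G_2)$ and $\Delta(\mathcal G_1)$ are bounded.
   Context: A graph class is a set of graphs closed under isomorphism containing a graph with non-empty vertex set; it is monotone if closed under subgraphs. For a graph parameter $\beta$, $\beta(\mathcal G):=\sup\{\beta(G):G\in\mathcal G\}$, bounded if finite. $\operatorname{tw}$ is treewidth, $\Delta$ is maximum degree, $\tilde{\mathsf v}(G)$ is the maximum number of vertices of a connected component of $G$, and $\tilde\tau(G)$ is the maximum vertex cover number of a connected component of $G$ (the vertex cover number of a graph is the minimum size of a vertex set whose complement is independent). $\mathcal G_1\times\mathcal G_2:=\{G_1\times G_2:G_i\in\mathcal G_i\}$, where the direct product $G_1 \times G_2$ has vertex set $V(G_1)\times V(G_2)$ and $(a,v)(b,u)$ is an edge iff $ab\in E(G_1)$ and $uv\in E(G_2)$. *)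

(* Defs.v *)
From Stdlib Require Import ClassicalEpsilon.
From mathcomp Require Import all_boot.
Set Implicit Arguments. Unset Strict Implicit. Unset Printing Implicit Defensive.

Record graph := Graph {
  gV : finType;
  gadj : rel gV;
  gsym : symmetric gadj;
  girr : irreflexive gadj }.

Definition iso (G H : graph) : Prop :=
  exists f : gV G -> gV H, bijective f /\
    forall x y, gadj x y = gadj (f x) (f y).

Definition subgraph (H G : graph) : Prop :=
  exists f : gV H -> gV G, injective f /\
    forall x y, gadj x y -> gadj (f x) (f y).

Definition graph_class (C : graph -> Prop) : Prop :=
  (forall G H, C G -> iso G H -> C H) /\ (exists G, C G /\ 0 < #|gV G|).

Definition monotone (C : graph -> Prop) : Prop :=
  forall G H, C G -> subgraph H G -> C H.

Definition K2 : graph.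
Proof.
refine (@Graph bool (fun x y => x != y) _ _).
- by move=> x y; rewrite eq_sym.
- by move=> x; rewrite eqxx.
Defined.

Definition gprod (G1 G2 : graph) : graph.
Proof.
refine (@Graph (gV G1 * gV G2)%type
          (fun p q => gadj p.1 q.1 && gadj p.2 q.2) _ _).
- by move=> p q; rewrite (gsym p.1) (gsym p.2).
- by move=> p; rewrite (girr p.1).
Defined.

Definition prod_class (C1 C2 : graph -> Prop) : graph -> Prop :=
  fun G => exists G1 G2, C1 G1 /\ C2 G2 /\ iso G (gprod G1 G2).

Definition bounded (beta : graph -> nat) (C : graph -> Prop) : Prop :=
  exists k, forall G, C G -> beta G <= k.

(* a tree: nonempty, connected, and minimally connected (every edge is a bridge) *)
Definition is_tree (T : finType) (e : rel T) : Prop :=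
  [/\ symmetric e, irreflexive e, 0 < #|T|,
      (forall x y, connect e x y) &
      (forall a b, e a b ->
         ~~ connect [rel x y | e x y && ~~ ((x == a) && (y == b))
                                     && ~~ ((x == b) && (y == a))] a b)].

Definition tree_decomp (G : graph) (T : finType) (e : rel T)
    (B : T -> {set gV G}) : Prop :=
  [/\ is_tree e,
      (forall v, exists t, v \in B t),
      (forall u v, gadj u v -> exists t, (u \in B t) && (v \in B t)) &
      (forall v t1 t2, v \in B t1 -> v \in B t2 ->
         connect [rel x y | e x y && (v \in B x) && (v \in B y)] t1 t2)].

Definition width (G : graph) (T : finType) (B : T -> {set gV G}) : nat :=
  (\max_(t : T) #|B t|).-1.

Definition has_tw_le (G : graph) (k : nat) : Prop :=
  exists (T : finType) (e : rel T) (B : T -> {set gV G}),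
    tree_decomp e B /\ width B <= k.

Lemma has_tw_le_ex (G : graph) : exists k, has_tw_le G k.
Proof.
exists #|gV G|; exists (unit : finType), (fun _ _ => false), (fun _ => setT).
split; last first.
  rewrite /width; apply: leq_trans (leq_pred _) _.
  by apply/bigmax_leqP => t _; rewrite cardsT.
split.
- split.
  + by [].
  + by [].
  + by rewrite card_unit.
  + by move=> [] []; exact: connect0.
  + by [].
- by move=> v; exists tt; rewrite inE.
- by move=> u v _; exists tt; rewrite !inE.
- by move=> v [] [] _ _; exact: connect0.
Qed.

Definition has_tw_leb (G : graph) (k : nat) : bool :=
  if excluded_middle_informative (has_tw_le G k) then true else false.

Lemma has_tw_leb_ex (G : graph) : exists k, has_tw_leb G k.
Proof.
have [k hk] := has_tw_le_ex G; exists k; rewrite /has_tw_leb.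
by case: excluded_middle_informative.
Qed.

Definition tw (G : graph) : nat := ex_minn (has_tw_leb_ex G).

Definition maxdeg (G : graph) : nat :=
  \max_(v : gV G) #|[set u | gadj v u]|.

Definition comp (G : graph) (v : gV G) : {set gV G} :=
  [set u | connect (@gadj G) v u].

Definition max_comp_size (G : graph) : nat :=
  \max_(v : gV G) #|comp v|.

Definition vertex_cover_in (G : graph) (C S : {set gV G}) : bool :=
  (S \subset C) &&
  [forall x, forall y, ((x \in C :\: S) && (y \in C :\: S)) ==> ~~ gadj x y].

Definition vc_in (G : graph) (C : {set gV G}) : nat :=
  \big[minn/#|C|]_(S : {set gV G} | vertex_cover_in C S) #|S|.

Definition max_comp_vc (G : graph) : nat :=
  \max_(v : gV G) vc_in (comp v).

(* Main.v *)
(** Treewidth is replaced throughout by weighted balanced separators: [G] is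
    [k]-separable if for every weighting of its vertices some at most [k] vertices
    leave only components of at most half the total weight. Up to constants
    this is equivalent to bounded treewidth.

    Bounded products: only one component [D] of [G1] can carry more than half of
    the weight, and the weight of [D x G2] is projected to [G2]. If [S] is a balanced
    separator there, then [D x S] works when [D] is small, and [X x N[S]] works when
    [X] is a small vertex cover of [D] and [G2] has bounded degree.

    Unbounded products: [n] disjoint connected rows crossing [n] disjoint connected
    columns rule out separators with fewer than [n / 2] vertices, and such families
    exist in path x path, star x star and path x spider, where a spider is a star with
    each edge subdivided once. Large components contain long paths or large stars;
    components of large vertex cover number contain long paths or large spiders.

    Finally [G x K2] controls [G]: if a component left by the projected separator is
    heavy in [G], then its double cover is disconnected, so it is bipartite and embeds
    in [G x K2], where it can be separated once more. *)

From Stdlib Require Import ClassicalEpsilon.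
From mathcomp Require Import all_boot zify.
Require Import Defs.
Set Implicit Arguments. Unset Strict Implicit. Unset Printing Implicit Defensive.

(** * From tree decompositions to balanced separators *)

Lemma connect_invariant (T : finType) (r : rel T) (P : T -> Prop) x y :
  (forall y z, r y z -> P y -> P z) -> connect r x y -> P x -> P y.
Proof.
move=> h /connectP [p]; elim: p x => [|z p IH] x /=; first by move=> _ ->.
by case/andP=> rxz pz ey /(h _ _ rxz); apply: IH.
Qed.

Lemma connect_map (T T' : finType) (r : rel T) (r' : rel T') (f : T -> T') x y :
  (forall x y, r x y -> connect r' (f x) (f y)) ->
  connect r x y -> connect r' (f x) (f y).
Proof.
move=> h cxy; apply: (connect_invariant (P := fun z => connect r' (f x) (f z)) _ cxy).
  by move=> u v /h huv /connect_trans; apply.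
exact: connect0.
Qed.

Lemma connect_symmetric (T : finType) (r : rel T) x y :
  symmetric r -> connect r x y -> connect r y x.
Proof. by move=> /sym_connect_sym hs; rewrite hs. Qed.

Section Separators.
Variable G : graph.
Implicit Types (A S : {set gV G}) (w : gV G -> nat).

Definition edgein A : rel (gV G) := [rel x y | [&& gadj x y, x \in A & y \in A]].

(** The set always contains [v]; it is just the singleton of [v] when [v] lies outside [A]. *)
Definition compin A v : {set gV G} := [set u | connect (edgein A) v u].

Definition balanced w S : Prop :=
  forall v, v \notin S -> 2 * \sum_(u in compin (~: S) v) w u <= \sum_u w u.

Definition separable k : Prop := forall w, exists S, #|S| <= k /\ balanced w S.

Lemma edgein_sym A : symmetric (edgein A).
Proof. by move=> x y; rewrite /edgein /= gsym; case: (x \in A); rewrite ?andbT ?andbF. Qed.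

Lemma edgeinS A A' x y : A \subset A' -> edgein A x y -> edgein A' x y.
Proof. by move=> /subsetP h /and3P [a b c]; rewrite /edgein /= a !h. Qed.

Lemma compinS A A' v : A \subset A' -> compin A v \subset compin A' v.
Proof.
move=> h; apply/subsetP=> u; rewrite !inE; apply: connect_sub => x y /(edgeinS h).
exact: connect1.
Qed.

Lemma compin_sub A v : v \in A -> compin A v \subset A.
Proof.
move=> hv; apply/subsetP=> u; rewrite inE => c.
by apply: (connect_invariant (P := fun z => z \in A) _ c) => // y z /and3P [].
Qed.

Lemma leq_sum_subset w A A' : A \subset A' -> \sum_(u in A) w u <= \sum_(u in A') w u.
Proof.
move=> h; rewrite [X in _ <= X](big_setID A) /= (setIidPr h).
exact: leq_addr.
Qed.

Lemma sum_disjoint w A A' :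
  [disjoint A & A'] -> \sum_(u in A) w u + \sum_(u in A') w u <= \sum_u w u.
Proof.
rewrite disjoints_subset => /(leq_sum_subset w) dA.
rewrite [X in _ <= X](bigID (mem A')) /= addnC leq_add2l.
by under [X in _ <= X]eq_bigl => u do rewrite -in_setC.
Qed.

End Separators.

Section TreeSides.
Variables (T : finType) (e : rel T).
Hypothesis treeT : is_tree e.

Definition avoid t : rel T := [rel x y | [&& e x y, x != t & y != t]].

(** For an edge [e t t'] this is the component of the tree minus [t] that contains [t']. *)
Definition side t t' : {set T} := [set x | connect (avoid t) t' x].

Lemma avoid_sym t : symmetric (avoid t).
Proof. by case: treeT => se _ _ _ _ x y; rewrite /avoid /= se (andbC (x != t)). Qed.

Lemma connect_exit t x :
  connect e t x -> t != x -> exists t', e t t' /\ x \in side t t'.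
Proof.
case/connectP=> p pp -> {x}; case/shortenP: pp => p' pp' up' _ {p}.
case: p' pp' up' => [|t' p] /=; first by rewrite eqxx.
case/andP=> ett' pp /andP [nt _] _; exists t'; split=> //; rewrite inE.
apply/connectP; exists p => //.
elim: p t' pp nt {ett'} => //= z p IH t' /andP [etz pz].
rewrite inE negb_or => /andP [h1 h2]; rewrite {}IH // andbT /avoid /= etz eq_sym h1.
by move: h2; rewrite inE negb_or eq_sym => /andP [].
Qed.

(** A common node would join [t] and [t'] by two walks, one avoiding [t] and one avoiding [t'].
    Neither uses the edge between them, which is a bridge. *)
Lemma sides_disjoint t t' : e t t' -> [disjoint side t t' & side t' t].
Proof.
case: treeT => se ie _ _ br ett'; rewrite disjoint_subset; apply/subsetP=> x.
rewrite !inE => c1; apply/negP=> c2; apply: (negP (br t t' ett')).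
apply: (@connect_trans _ _ x).
  apply: connect_sub c2 => y z /and3P [eyz hy hz]; apply: connect1 => /=.
  by rewrite eyz (negbTE hy) (negbTE hz) andbF.
apply: connect_sub (connect_symmetric (avoid_sym t) c1) => y z /and3P [eyz hy hz].
by apply: connect1 => /=; rewrite eyz (negbTE hy) (negbTE hz) andbF.
Qed.

(** The node [t'] gives strictness. For the inclusion, a walk from [t''] avoiding [t'] cannot reach
    [t]: extended by the edge from [t] to [t'] it would bypass the bridge between [t'] and [t'']. *)
Lemma side_proper t t' t'' :
  e t t' -> e t' t'' -> t'' != t -> side t' t'' \proper side t t'.
Proof.
case: treeT => se ie _ _ br ett' et't'' ntt; apply/properP; split; last first.
  exists t'; first by rewrite inE connect0.
  rewrite inE; apply/negP=> c.
  have : t' != t' by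
    apply: (connect_invariant (P := fun z => z != t') _ c) => [y z /and3P []//|];
    apply: contraTneq et't'' => ->; rewrite ie.
  by rewrite eqxx.
have nt' : t'' != t' by apply: contraTneq et't'' => ->; rewrite ie.
apply/subsetP=> x; rewrite !inE => c.
have [_ ] : connect (avoid t') t'' x /\ (x \in side t t') && (x != t'); last first.
  by rewrite inE => /andP [].
apply: (connect_invariant
  (P := fun z => connect (avoid t') t'' z /\ (z \in side t t') && (z != t')) _ c).
  move=> y z hyz [cy /andP [hy1 hy2]].
  have cz := connect_trans cy (connect1 hyz).
  split=> //; case/and3P: hyz => eyz _ hz; rewrite hz andbT inE.
  have hs: forall z, connect (avoid t') t'' z -> z != t.
    move=> u cu; apply/negP=> /eqP uE; rewrite {u}uE in cu.
    have et't : e t' t by rewrite se.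
    apply: (negP (br _ _ et't'')); apply: (@connect_trans _ _ t).
      apply: connect1 => /=; rewrite et't eqxx /= eq_sym (negbTE ntt) /=.
      by rewrite eq_sym (negbTE nt').
    apply: connect_sub (connect_symmetric (avoid_sym t') cu) => a b /and3P [eab ha hb].
    by apply: connect1 => /=; rewrite eab (negbTE ha) (negbTE hb) andbF.
  rewrite inE in hy1; apply: connect_trans hy1 (connect1 _).
  by rewrite /avoid /= eyz !hs.
split; first exact: connect0.
rewrite nt' andbT inE; apply: connect1; rewrite /avoid /= et't'' ntt andbT.
by apply: contraTneq ett' => ->; rewrite ie.
Qed.

End TreeSides.

Section TreeToSeparator.
Variables (G : graph) (T : finType) (e : rel T) (B : T -> {set gV G}).
Hypothesis tdB : tree_decomp e B.

(** The bags of a vertex outside [B t] form a connected set missing [t], hence lie on one side of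
    [t]. Adjacent vertices share a bag, so this side is constant along a component. *)
Lemma comp_in_side t v : v \notin B t ->
  exists t', e t t' /\ forall u x, u \in compin (~: B t) v -> u \in B x -> x \in side e t t'.
Proof.
case: tdB => treeT cov edg con hv.
have same_side t' u x y : u \notin B t -> u \in B x -> u \in B y ->
    x \in side e t t' -> y \in side e t t'.
  rewrite !inE => hu ux uy c; apply: connect_trans c _.
  apply: connect_sub (con u x y ux uy) => a b /= /andP [/andP [eab ua] ub].
  apply: connect1; rewrite /avoid /= eab /=; apply/andP; split.
    by apply: contraTneq ua => ->.
  by apply: contraTneq ub => ->.
have [x0 vx0] := cov v.
have ntx : t != x0 by apply: contraNneq hv => ->.
have ctx : connect e t x0 by case: treeT.
have [t' [ett' hx0]] := connect_exit ctx ntx.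
exists t'; split=> // u x; rewrite inE => c.
have [_ h] : u \notin B t /\ (forall x, u \in B x -> x \in side e t t'); last exact: h.
apply: (connect_invariant (P := fun u => u \notin B t /\
          (forall x, u \in B x -> x \in side e t t')) _ c).
  move=> y z /and3P []; rewrite !inE => ayz hy hz [_ IH]; split=> // b zb.
  have [a /andP [ya za]] := edg _ _ ayz.
  exact: same_side hz za zb (IH _ ya).
by split=> // b vb; apply: same_side hv vx0 vb hx0.
Qed.

(** If no bag were balanced, each node would point to the side of its heavy component. Following the
    pointers shrinks the side strictly until a pointer turns back; then two disjoint components each
    carry more than half of the weight. *)
Lemma tree_decomp_balanced (w : gV G -> nat) : exists t, balanced w (B t).
Proof.
apply: NNPP => nex.
have heavy t : exists v, v \notin B t /\
    \sum_u w u < 2 * \sum_(u in compin (~: B t) v) w u.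
  apply: NNPP => nv; apply: nex; exists t => v hv; rewrite leqNgt.
  by apply/negP => hlt; apply: nv; exists v.
have treeT : is_tree e by case: tdB.
have descent n t t' v : #|side e t t'| <= n -> e t t' -> v \notin B t ->
    \sum_u w u < 2 * \sum_(u in compin (~: B t) v) w u ->
    (forall u x, u \in compin (~: B t) v -> u \in B x -> x \in side e t t') -> False.
  elim: n t t' v => [|n IH] t t' v hn ett' hv wv hs.
    have: t' \in side e t t' by rewrite inE connect0.
    by move: hn; rewrite leqn0 cards_eq0 => /eqP ->; rewrite inE.
  have [v' [hv' wv']] := heavy t'.
  have [t'' [et't'' hs']] := comp_in_side hv'.
  have [tE|ntt] := eqVneq t'' t; last first.
    apply: (IH t' t'' v') => //; rewrite -ltnS; apply: leq_trans hn.
    exact/proper_card/side_proper.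
  rewrite {t''}tE in et't'' hs'.
  suff dK : [disjoint compin (~: B t) v & compin (~: B t') v'].
    by have := sum_disjoint w dK; lia.
  rewrite disjoint_subset; apply/subsetP => u hu; rewrite inE /=; apply/negP => hu'.
  case: tdB => _ /(_ u) [x ux] _ _.
  have := sides_disjoint treeT ett'; rewrite disjoint_subset.
  by move/subsetP/(_ x (hs _ _ hu ux)); rewrite inE (hs' _ _ hu' ux).
have [t _] : exists t : T, true.
  by case: treeT => _ _ /card_gt0P [t _] _ _; exists t.
have [v [hv wv]] := heavy t; have [t' [ett' hs]] := comp_in_side hv.
exact: (descent _ t t' v (leqnn _)).
Qed.

End TreeToSeparator.

Lemma has_tw_le_separable G k : has_tw_le G k -> separable G k.+1.
Proof.
case=> T [e [B [tdB hw]]] w; have [t ht] := tree_decomp_balanced tdB w.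
exists (B t); split=> //; apply: leq_trans (leq_bigmax (F := fun t => #|B t|) t) _.
by move: hw; rewrite /width; lia.
Qed.

(** * From balanced separators to tree decompositions *)

Section JoinTrees.
Variables (T1 T2 : finType) (e1 : rel T1) (e2 : rel T2) (t1 : T1) (t2 : T2).

Definition join_tree : rel (T1 + T2) := fun x y =>
  match x, y with
  | inl a, inl b => e1 a b
  | inr a, inr b => e2 a b
  | inl a, inr b => (a == t1) && (b == t2)
  | inr a, inl b => (a == t2) && (b == t1)
  end.

(** Only the new edge joins the two halves, so it is a bridge. An old edge remains one because
    contracting the other tree to its attaching node (the maps [f] below) sends walks avoiding that
    edge to walks avoiding it. *)
Lemma join_tree_is_tree : is_tree e1 -> is_tree e2 -> is_tree join_tree.
Proof.
case=> s1 i1 n1 c1 b1 [s2 i2 n2 c2 b2].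
have sJ : symmetric join_tree 
  by move=> [x|x] [y|y] /=; [exact: s1|exact: andbC|exact: andbC|exact: s2].
have cl x y : connect join_tree (inl x) (inl y).
  by apply: connect_map (c1 x y) => a b eab; apply: connect1.
have cr x y : connect join_tree (inr x) (inr y).
  by apply: connect_map (c2 x y) => a b eab; apply: connect1.
have clr x y : connect join_tree (inl x) (inr y).
  apply: connect_trans (cl x t1) _; apply: connect_trans (cr t2 y).
  by apply: connect1; rewrite /= !eqxx.
split=> //.
- by move=> [x|x] /=.
- by apply/card_gt0P; exists (inl t1).
- by move=> [x|x] [y|y] //; apply: connect_symmetric.
have link a b : a = t1 -> b = t2 -> ~~ connect
    [rel x y | join_tree x y && ~~ ((x == inl a) && (y == inr b))
                             && ~~ ((x == inr b) && (y == inl a))] (inl a) (inr b).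
  move=> -> ->; apply/negP => c.
  suff: if @inr T1 T2 t2 is inl _ then true else false by [].
  apply: (connect_invariant (P := fun z => if z is inl _ then true else false) _ c) => //.
  move=> [x|x] [y|y] //= /andP [/andP [/andP [/eqP -> /eqP ->]]].
  by rewrite !eqxx.
move=> [a|a] [b|b] /= eab.
- apply: contra (b1 a b eab) => c.
  pose f (z : T1 + T2) := if z is inl x then x else t1.
  apply: (connect_map (f := f) _ c) => [[x|x] [y|y]] /=.
  + by move=> h; apply: connect1.
  + by case/andP=> /andP [/andP [/eqP -> _] _ _]; exact: connect0.
  + by case/andP=> /andP [/andP [_ /eqP ->] _ _]; exact: connect0.
  + by move=> _; exact: connect0.
- by case/andP: eab => /eqP ea /eqP eb; apply: link.
- case/andP: eab => /eqP ea /eqP eb; apply: contra (link _ _ eb ea) => c.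
  apply: connect_symmetric.
    by move=> x y /=; rewrite sJ -!andbA; congr andb; rewrite andbC (andbC (y == _)) (andbC (y == inr _)).
  by apply: connect_sub c => x y h; apply: connect1; rewrite /= -andbA (andbC (~~ _)) andbA.
- apply: contra (b2 a b eab) => c.
  pose f (z : T1 + T2) := if z is inr x then x else t2.
  apply: (connect_map (f := f) _ c) => [[x|x] [y|y]] /=.
  + by move=> _; exact: connect0.
  + by case/andP=> /andP [/andP [_ /eqP ->] _ _]; exact: connect0.
  + by case/andP=> /andP [/andP [/eqP -> _] _ _]; exact: connect0.
  + by move=> h; apply: connect1.
Qed.

End JoinTrees.

Section SeparatorToTree.
Variable G : graph.
Implicit Types (U W S R X : {set gV G}).

Lemma sum_indicator (A W : {set gV G}) : \sum_(u in A) (u \in W : nat) = #|A :&: W|.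
Proof.
rewrite -sum1_card (eq_bigl _ _ (fun u => in_setI u A W)) [RHS]big_mkcondr.
by apply: eq_bigr => u _; case: (u \in W).
Qed.

(** A tree decomposition of the subgraph induced on [U]; the bag containing [W] is where further
    decompositions get attached. *)
Definition td_on c W U : Prop :=
  exists (T : finType) (e : rel T) (B : T -> {set gV G}),
  [/\ is_tree e,
      forall t, (B t \subset U) && (#|B t| <= c),
      forall v, v \in U -> exists t, v \in B t,
      forall u v, u \in U -> v \in U -> gadj u v -> exists t, (u \in B t) && (v \in B t) &
      forall v t1 t2, v \in B t1 -> v \in B t2 ->
         connect [rel x y | e x y && (v \in B x) && (v \in B y)] t1 t2]
  /\ exists t, W \subset B t.

Lemma td_on_single c R : #|R| <= c -> td_on c R R.
Proof.
move=> hc; exists (unit : finType), (fun _ _ => false), (fun _ => R); split; last by exists tt.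
split.
- split=> //; first by rewrite card_unit.
  by move=> [] []; exact: connect0.
- by move=> _; rewrite subxx.
- by move=> v hv; exists tt.
- by move=> u v hu hv _; exists tt; rewrite hu.
- by move=> v [] [] _ _; exact: connect0.
Qed.

Lemma td_on_sub c W W' U : W' \subset W -> td_on c W U -> td_on c W' U.
Proof.
move=> h [T [e [B [tdB [t ht]]]]]; exists T, e, B; split=> //.
by exists t; apply: subset_trans ht.
Qed.

(** The two trees are joined at the bags containing [W1] and [W2]. Shared vertices lie in both of
    these bags, so the nodes whose bags contain a given vertex stay connected. *)
Lemma td_on_glue c W1 W2 U1 U2 :
  td_on c W1 U1 -> td_on c W2 U2 -> U1 :&: U2 \subset W1 -> U1 :&: U2 \subset W2 ->
  (forall x y, x \in U1 -> y \in U2 -> gadj x y -> (x \in U2) || (y \in U1)) ->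
  td_on c W1 (U1 :|: U2).
Proof.
move=> [T1 [e1 [B1 [[tr1 s1 v1 d1 c1] [t1 h1]]]]].
move=> [T2 [e2 [B2 [[tr2 s2 v2 d2 c2] [t2 h2]]]]] /subsetP i1 /subsetP i2 noedge.
pose B (z : T1 + T2) := match z with inl x => B1 x | inr x => B2 x end.
exists (T1 + T2)%type, (join_tree e1 e2 t1 t2), B; split; last by exists (inl t1).
have sJ : symmetric (join_tree e1 e2 t1 t2).
  by case: (join_tree_is_tree t1 t2 tr1 tr2).
split.
- exact: join_tree_is_tree.
- move=> [t|t] /=; [case/andP: (s1 t) => h -> | case/andP: (s2 t) => h ->];
  by rewrite andbT; apply: subset_trans h _; rewrite ?subsetUl ?subsetUr.
- move=> v; rewrite inE => /orP [/v1 [t]|/v2 [t]] h; [by exists (inl t)|by exists (inr t)].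
- have one u v : u \in U1 -> v \in U1 -> gadj u v -> exists t, (u \in B t) && (v \in B t).
    by move=> hu hv /(d1 _ _ hu hv) [t]; exists (inl t).
  have two u v : u \in U2 -> v \in U2 -> gadj u v -> exists t, (u \in B t) && (v \in B t).
    by move=> hu hv /(d2 _ _ hu hv) [t]; exists (inr t).
  move=> u v; rewrite !inE => /orP [hu|hu] /orP [hv|hv] a; try by [apply: one|apply: two].
    by case/orP: (noedge _ _ hu hv a) => h; [apply: two|apply: one].
  have a' : gadj v u by rewrite gsym.
  by case/orP: (noedge _ _ hv hu a') => h; [apply: two|apply: one].
move=> v.
pose r := [rel x y | join_tree e1 e2 t1 t2 x y && (v \in B x) && (v \in B y)].
have sr : symmetric r by move=> x y; rewrite /r /= sJ -!andbA; congr andb; rewrite andbC.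
have cl x y : v \in B1 x -> v \in B1 y -> connect r (inl x) (inl y).
  move=> hx hy; apply: connect_map (c1 v x y hx hy) => a b eab; exact: connect1.
have cr x y : v \in B2 x -> v \in B2 y -> connect r (inr x) (inr y).
  move=> hx hy; apply: connect_map (c2 v x y hx hy) => a b eab; exact: connect1.
have clr x y : v \in B1 x -> v \in B2 y -> connect r (inl x) (inr y).
  move=> hx hy.
  have vU : v \in U1 :&: U2.
    case/andP: (s1 x) => /subsetP /(_ _ hx) hU1 _.
    by case/andP: (s2 y) => /subsetP /(_ _ hy) hU2 _; rewrite inE hU1.
  have vt1 := subsetP h1 _ (i1 _ vU); have vt2 := subsetP h2 _ (i2 _ vU).
  apply: connect_trans (cl x t1 hx vt1) _; apply: connect_trans (cr t2 y vt2 hy).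
  by apply: connect1; rewrite /r /= !eqxx vt1 vt2.
move=> [x|x] [y|y] hx hy; [exact: cl|exact: clr| |exact: cr].
by apply: connect_symmetric => //; apply: clr.
Qed.

(** The root bag consists of [W], one new vertex and a balanced separator, at most [(2 * k).+1 + k]
    vertices. Each remaining component is decomposed recursively with a boundary of at most [2 * k]
    vertices and attached to the root. *)
Lemma separable_td_on k U W :
  separable G k -> W \subset U -> #|W| <= 2 * k -> td_on (3 * k).+1 W U.
Proof.
move=> sepG; move: {2}#|U :\: W| (leqnn #|U :\: W|) => n.
elim: n U W => [|n IH] U W hn sWU hW.
  have -> : U = W.
    by apply/eqP; rewrite eqEsubset sWU andbT -setD_eq0 -cards_eq0 -leqn0.
  by apply: td_on_single; lia.
have [D0|[z hz]] := set_0Vmem (U :\: W).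
  by apply: IH => //; rewrite D0 cards0.
have /setDP [zU zW] := hz.
(* Adding [z] makes every recursive call strictly smaller: [z] counts in [U :\: W], but if it lies
   in a piece at all, it lies in the boundary of that piece. *)
pose Wz := z |: W.
have cWz : #|Wz| <= (2 * k).+1 by rewrite cardsU1 zW; lia.
have sWz : Wz \subset U by rewrite subUset sub1set zU.
have [S [hS balS]] := sepG (fun u => u \in Wz : nat).
pose R := Wz :|: (S :&: U); pose A := U :\: S.
have cR : #|R| <= (3 * k).+1.
  have : #|R| <= #|Wz| + #|S :&: U| by apply: leq_card_setU.
  have := subset_leq_card (subsetIl S U).
  by lia.
(* [X] runs over unions of components of [A], which are split off and glued to the root bag one at a
   time. *)
suff claim m X : #|X| <= m -> X \subset A ->
    (forall x y, x \in X -> edgein A x y -> y \in X) -> td_on (3 * k).+1 R (R :|: X).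
  have -> : U = R :|: A.
    apply/setP=> x; rewrite !inE; have := subsetP sWz x; rewrite !inE.
    by case: (x \in U) => h; rewrite ?andbT ?andbF ?orbF; [case: (x \in S); rewrite ?orbT|case: (_ || _) h => // ->].
  have sWR : W \subset R by apply: subset_trans (subsetUr [set z] W) (subsetUl _ _).
  apply: td_on_sub sWR _; apply: (claim #|A|) => // x y _.
  by case/and3P.
elim: m X => [|m IHm] X hm sXA clX.
  move: hm; rewrite leqn0 cards_eq0 => /eqP ->; rewrite setU0; exact: td_on_single.
have [->|[v vX]] := set_0Vmem X; first by rewrite setU0; exact: td_on_single.
have vA := subsetP sXA _ vX.
pose K := compin A v.
have sKA : K \subset A := compin_sub vA.
have sKX : K \subset X.
  apply/subsetP=> u; rewrite inE => c.
  by apply: (connect_invariant (P := fun z => z \in X) _ c) => // x y exy hx; apply: clX exy.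
have clK x y : x \in K -> edgein A x y -> y \in K.
  by rewrite !inE => c exy; apply: connect_trans c (connect1 exy).
pose WK := (K :&: Wz) :|: (S :&: U).
have vK : v \in K by rewrite inE connect0.
have vnS : v \notin S by move: vA; rewrite inE => /andP [].
(* Balance for the indicator of [Wz] gives [2 * #|K :&: Wz| <= (2 * k).+1], and integrality does the
   rest. *)
have cKW : #|K :&: Wz| <= k.
  have sA : A \subset ~: S by apply/subsetP=> x; rewrite !inE => /andP [].
  have := balS v vnS.
  have -> : \sum_(u in compin (~: S) v) (u \in Wz : nat) = #|compin (~: S) v :&: Wz|.
    exact: sum_indicator.
  have : #|K :&: Wz| <= #|compin (~: S) v :&: Wz| by apply/subset_leq_card/setSI/compinS.
  have -> : \sum_u (u \in Wz : nat) = #|Wz|.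
    by rewrite -{2}(setTI Wz) -sum_indicator; apply: eq_bigl => u; rewrite inE.
  lia.
have tdK : td_on (3 * k).+1 WK (K :|: (S :&: U)).
  apply: IH; last 2 first.
  - by rewrite setUSS ?subsetIl.
  - have : #|WK| <= #|K :&: Wz| + #|S :&: U| by apply: leq_card_setU.
    have := subset_leq_card (subsetIl S U).
    by lia.
  rewrite -ltnS; apply: leq_trans hn; apply: proper_card; apply/properP; split.
    apply/subsetP=> x /setDP [/setUP [h|h]]; last by rewrite inE h orbT.
    have xU : x \in U by have := subsetP sKA _ h; rewrite inE => /andP [].
    rewrite [x \in WK]inE [x \in K :&: Wz]inE h negb_or /= => /andP [hw _].
    by rewrite inE xU andbT; apply: contra hw; apply: setU1r.
  exists z; first by rewrite inE zW.
  apply/setDP => -[/setUP [h|h]]; rewrite inE ?h ?orbT // [z \in K :&: _]inE h.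
  by rewrite setU11.
have -> : R :|: X = (R :|: (X :\: K)) :|: (K :|: (S :&: U)).
  apply/setP=> x; rewrite !inE; have := subsetP sKX x; rewrite inE.
  case: (connect _ _ _); case: (x \in X); case: (x \in S); case: (x \in U);
    by case: (x == z); case: (x \in W) => //= /(_ isT).
apply: td_on_glue tdK _ _ _.
- apply: IHm.
  + rewrite -ltnS; apply: leq_trans hm; apply: proper_card; apply/properP.
    by split; [exact: subsetDl|exists v => //; rewrite inE vK].
  + by apply: subset_trans sXA; exact: subsetDl.
  + move=> x y /setDP [xX xK] exy; rewrite inE (clX x y) // andbT.
    by apply: contra xK => yK; apply: clK yK _; rewrite edgein_sym.
- apply/subsetP=> x /setIP [/setUP [//|/setDP [_ h]] /setUP [h'|h']].
    by rewrite h' in h.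
  by rewrite inE h' orbT.
- apply/subsetP=> x /setIP [h1 /setUP [h2|h2]]; last by rewrite inE h2 orbT.
  have xS : x \notin S by have := subsetP sKA _ h2; rewrite inE => /andP [].
  case/setUP: h1 => [/setUP [h|/setIP [h _]]|/setDP [_ h]].
  + by rewrite inE [x \in _ :&: _]inE h2 h.
  + by rewrite h in xS.
  + by rewrite h2 in h.
move=> x y hx /setUP [hy|hy] axy; last by rewrite orbC inE [y \in R]inE hy orbT.
have xU : x \in U.
  case/setUP: hx => [/setUP [/(subsetP sWz)//|/setIP []//]|/setDP [/(subsetP sXA)]].
  by rewrite inE => /andP [].
have [xS|xS] := boolP (x \in S); first by rewrite !inE xS xU /= orbT.
rewrite inE (clK y x) // /edgein /= gsym axy (subsetP sKA) //.
by rewrite !inE xS xU.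
Qed.

Lemma separable_has_tw_le k : separable G k -> has_tw_le G (3 * k).
Proof.
move=> /separable_td_on h.
have [||T [e [B [[tr s v d c] _]]]] := h setT set0; [exact: subsetT|by rewrite cards0|].
exists T, e, B; split; last first.
  rewrite /width -ltnS; apply: leq_ltn_trans (_ : (3 * k).+1.-1 < _) => //.
  rewrite -subn1 -[X in _ <= X]subn1; apply: leq_sub2r; apply/bigmax_leqP => t _.
  by case/andP: (s t).
split=> //.
- by move=> u; apply: v; rewrite inE.
- by move=> u u' a; apply: d => //; rewrite inE.
Qed.

End SeparatorToTree.

(** * Separators of products *)

Lemma leq_sum_pred (T : finType) (P Q : pred T) (w : T -> nat) :
  (forall x, P x -> Q x) -> \sum_(x | P x) w x <= \sum_(x | Q x) w x.
Proof.
move=> h; rewrite [X in X <= _]big_mkcond [X in _ <= X]big_mkcond; apply: leq_sum => x _.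
by case: ifP => // /h ->.
Qed.

Lemma sum_fiber (T T' : finType) (f : T -> T') (P : pred T) (K : {set T'}) (w : T -> nat) :
  \sum_(h in K) \sum_(x | P x && (f x == h)) w x = \sum_(x | P x && (f x \in K)) w x.
Proof.
symmetry; rewrite (partition_big f (mem K)) => [|x /andP[]//].
apply: eq_bigr => h hK; apply: eq_bigl => x; case: (P x) => //=.
by case: eqP => [->|]; rewrite ?andbF ?andbT.
Qed.

Lemma sum_fiberT (T T' : finType) (f : T -> T') (P : pred T) (w : T -> nat) :
  \sum_h \sum_(x | P x && (f x == h)) w x = \sum_(x | P x) w x.
Proof. by rewrite [RHS](partition_big f predT). Qed.

Lemma card_bigcup_leq (I T : finType) (A : {set I}) (F : I -> {set T}) d :
  (forall i, i \in A -> #|F i| <= d) -> #|\bigcup_(i in A) F i| <= #|A| * d.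
Proof.
move=> h; rewrite -sum_nat_const.
apply: (big_ind2 (fun (s : {set T}) n => #|s| <= n)) => //; first by rewrite cards0.
move=> s1 n1 s2 n2 h1 h2; apply: leq_trans (leq_add h1 h2).
by apply: leq_card_setU.
Qed.

Lemma tw_has_tw_le G : has_tw_le G (tw G).
Proof.
rewrite /tw; case: ex_minnP => k; rewrite /has_tw_leb.
by case: excluded_middle_informative.
Qed.

Lemma has_tw_le_tw G k : has_tw_le G k -> tw G <= k.
Proof.
rewrite /tw; case: ex_minnP => m _ hm h; apply: hm; rewrite /has_tw_leb.
by case: excluded_middle_informative.
Qed.

Lemma bounded_tw_separable (C : graph -> Prop) :
  bounded tw C <-> exists k, forall G, C G -> separable G k.
Proof.
split=> -[k hk].
  exists k.+1 => G /hk hG w; have [S [hS bS]] := has_tw_le_separable (tw_has_tw_le G) w.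
  by exists S; split=> //; lia.
by exists (3 * k) => G /hk /separable_has_tw_le /has_tw_le_tw.
Qed.

(** The weight is pushed forward along the embedding and the separator pulled back; components map
    into components. *)
Lemma separable_subgraph H G k : subgraph H G -> separable G k -> separable H k.
Proof.
move=> [f [injf homf]] sG w.
have [S [hS bS]] := sG (fun h => \sum_(x | true && (f x == h)) w x).
exists (f @^-1: S); split.
  apply: leq_trans hS; rewrite -(card_imset _ injf); apply: subset_leq_card.
  by apply/subsetP=> _ /imsetP [x xS ->]; rewrite inE in xS.
move=> v; rewrite inE => /bS; rewrite sum_fiberT sum_fiber; apply: leq_trans.
rewrite leq_mul2l /=; apply: leq_sum_pred => u; rewrite !inE.
apply: connect_map => x y /and3P [axy hx hy]; apply: connect1.
by rewrite !inE in hx hy; rewrite /edgein /= homf // !inE hx hy.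
Qed.

Lemma separable_gprodC G1 G2 k : separable (gprod G1 G2) k -> separable (gprod G2 G1) k.
Proof.
apply: separable_subgraph; exists (fun p => (p.2, p.1)); split; first by move=> [a b] [c d] [-> ->].
by move=> x y /andP [h1 h2]; apply/andP.
Qed.

Lemma comp_closed (G : graph) (v x y : gV G) : x \in comp v -> gadj x y -> y \in comp v.
Proof. by rewrite !inE => c a; apply: connect_trans c (connect1 a). Qed.

Section ProductSeparators.
Variables G1 G2 : graph.
Local Notation H := (gprod G1 G2).
Implicit Types (w : gV H -> nat) (D : {set gV G1}).

(** Common frame of both product bounds. Components outside [D] are light since [D] is heavy. A
    component starting off [S2] never enters the fibres over [S2], so it projects into one component
    of [G2] minus [S2]. Components starting over [S2] are left to the last hypothesis. *)
Lemma balanced_prod w D (S2 : {set gV G2}) (S : {set gV H}) :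
  (forall x y, x \in D -> gadj x y -> y \in D) ->
  \sum_p w p < 2 * \sum_(p : gV H | p.1 \in D) w p ->
  balanced (fun v => \sum_(p : gV H | (p.1 \in D) && (p.2 == v)) w p) S2 ->
  (forall p q : gV H, edgein (~: S) p q -> p.1 \in D -> p.2 \notin S2 -> q.2 \notin S2) ->
  (forall p : gV H, p \notin S -> p.1 \in D -> p.2 \in S2 ->
     2 * \sum_(u in compin (~: S) p) w u <= \sum_p w p) ->
  balanced w S.
Proof.
move=> clD heavy bS2 stay inS2 p hp.
have tot : \sum_p w p = \sum_(p : gV H | p.1 \in D) w p + \sum_(p : gV H | p.1 \notin D) w p.
  by rewrite (bigID (fun p : gV H => p.1 \in D)).
have [pD|pD] := boolP (p.1 \in D); last first.
  suff : \sum_(u in compin (~: S) p) w u <= \sum_(q : gV H | q.1 \notin D) w q by lia.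
  apply: leq_sum_pred => q; rewrite inE => c.
  apply: (connect_invariant (P := fun q : gV H => q.1 \notin D) _ c) => // x y.
  by case/and3P => /andP [a _] _ _; apply: contra => h; apply: clD h _; rewrite gsym.
have [pS|pS] := boolP (p.2 \in S2); first exact: inS2.
have := bS2 _ pS; rewrite sum_fiberT sum_fiber => h.
suff : \sum_(u in compin (~: S) p) w u <=
       \sum_(q : gV H | (q.1 \in D) && (q.2 \in compin (~: S2) p.2)) w q by lia.
apply: leq_sum_pred => q; rewrite inE => c.
have [] // : (q.1 \in D) && (q.2 \in compin (~: S2) p.2) /\ q.2 \notin S2.
apply: (connect_invariant (P := fun q : gV H =>
  (q.1 \in D) && (q.2 \in compin (~: S2) p.2) /\ q.2 \notin S2) _ c); last first.
  by rewrite pD inE connect0.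
move=> x y exy [/andP [xD xc] xS].
have yS := stay _ _ exy xD xS; split=> //.
case/and3P: exy => /andP [a1 a2] _ _; rewrite (clD _ _ xD a1) /=.
rewrite !inE in xc *; apply: connect_trans xc (connect1 _).
by rewrite /edgein /= a2 !inE xS yS.
Qed.

(** Each component of the product projects into a component of [G1], so without a heavy one nothing
    has to be removed. *)
Lemma heavy_factor_component w :
  balanced w set0 \/
  exists x, \sum_p w p < 2 * \sum_(p : gV H | p.1 \in comp x) w p.
Proof.
have [?|h] := classic (exists x, \sum_p w p < 2 * \sum_(p : gV H | p.1 \in comp x) w p).
  by right.
left=> p _; rewrite leqNgt; apply/negP => hlt; apply: h; exists p.1.
apply: leq_trans hlt _; rewrite leq_mul2l /=; apply: leq_sum_pred => q.
rewrite !inE; apply: connect_map => x y /and3P [/andP [a _] _ _]; exact: connect1.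
Qed.

Lemma separable_prod_comp_size m k :
  max_comp_size G1 <= m -> separable G2 k -> separable H (m * k).
Proof.
move=> hm sG2 w; have [b|[x hx]] := heavy_factor_component w.
  by exists set0; rewrite cards0.
have [S2 [hS2 bS2]] := sG2 (fun v => \sum_(p : gV H | (p.1 \in comp x) && (p.2 == v)) w p).
exists (setX (comp x) S2); split.
  rewrite cardsX leq_mul //; apply: leq_trans hm.
  exact: (leq_bigmax (F := fun v => #|comp v|)).
apply: (balanced_prod (@comp_closed _ x) hx bS2).
  move=> p q /and3P [/andP [a _] _]; rewrite in_setC inE negb_and => /orP [h|//] hp.
  by rewrite (comp_closed hp a) in h.
by move=> p; rewrite inE negb_and => /orP [/negbTE ->|/negbTE ->].
Qed.

Lemma vc_in_cover (G : graph) (C : {set gV G}) :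
  exists S, vertex_cover_in C S /\ #|S| = vc_in C.
Proof.
rewrite /vc_in; apply: (big_ind (fun n => exists S, vertex_cover_in C S /\ #|S| = n)).
(* The default value of the minimum is attained too, since [C] covers itself. *)
- exists C; split=> //; rewrite /vertex_cover_in subxx /=.
  by apply/forallP=> x; apply/forallP=> y; rewrite setDv inE.
- by move=> m n hm hn; rewrite /minn; case: ifP.
- by move=> S hS; exists S.
Qed.

(** The factor [k * d.+1] bounds the closed neighbourhood [N] of the separator of [G2]; the outer
    successor leaves room for a separator made of one heavy vertex. *)
Lemma separable_prod_comp_vc t d k :
  max_comp_vc G1 <= t -> maxdeg G2 <= d -> separable G2 k ->
  separable H (t * (k * d.+1)).+1.
Proof.
move=> ht hd sG2 w; have [b|[x hx]] := heavy_factor_component w.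
  by exists set0; rewrite cards0.
have [[p hp]|light] := classic (exists p, \sum_p w p < 2 * w p).
  exists [set p]; rewrite cards1; split=> // q hq.
  have h' := @sum_disjoint _ w [set p] (compin (~: [set p]) q).
  rewrite big_set1 disjoints_subset sub1set inE in h'.
  suff : p \notin compin (~: [set p]) q by move=> /h'; lia.
  apply/negP => /(subsetP (@compin_sub _ (~: [set p]) q _)); rewrite !inE in hq *.
  by move/(_ hq); rewrite eqxx.
have [S2 [hS2 bS2]] := sG2 (fun v => \sum_(p : gV H | (p.1 \in comp x) && (p.2 == v)) w p).
have [X [coverX cX]] := vc_in_cover (comp x).
pose N := \bigcup_(v in S2) (v |: [set u | gadj v u]).
have inN v u : v \in S2 -> (u == v) || gadj v u -> u \in N.
  by move=> hv h; apply/bigcupP; exists v => //; rewrite !inE.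
have cN : #|N| <= k * d.+1.
  apply: leq_trans (card_bigcup_leq (d := d.+1) _) _; last by rewrite leq_mul2r hS2 orbT.
  move=> v _; rewrite cardsU1 -add1n leq_add ?leq_b1 //; apply: leq_trans hd.
  exact: (leq_bigmax (F := fun v => #|[set u | gadj v u]|)).
have cover y z : y \in comp x -> z \in comp x -> gadj y z -> (y \in X) || (z \in X).
  case/andP: coverX => _ /forallP /(_ y) /forallP /(_ z).
  rewrite !in_setD => h hy hz a; move: h; rewrite hy hz a.
  by case: (y \in X); case: (z \in X).
exists (setX X N); split.
  rewrite cardsX; apply: leqW; apply: leq_mul => //; rewrite cX; apply: leq_trans ht.
  exact: (leq_bigmax (F := fun v => vc_in (comp v))).
apply: (balanced_prod (@comp_closed _ x) hx bS2).
  (* An edge entering the fibres over [S2] has both second coordinates in [N] and one first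
     coordinate in the cover [X], so one of its ends was removed. *)
  move=> p q /and3P [/andP [a1 a2]]; rewrite !in_setC [p \in _]inE [q \in _]inE !negb_and => hp hq pD pS.
  apply/negP => qS; have qD := comp_closed pD a1.
  have pN : p.2 \in N by apply: inN qS _; rewrite gsym a2 orbT.
  have qN : q.2 \in N by apply: inN qS _; rewrite eqxx.
  move: hp hq; rewrite pN qN !orbF => /negbTE h1 /negbTE h2.
  by have := cover _ _ pD qD a1; rewrite h1 h2.
(* A surviving vertex over [S2] has first coordinate outside [X], so all its neighbours lie in
   [setX X N]. Its component is a single vertex, which is not heavy. *)
move=> p; rewrite inE => hp pD pS.
have pN : p.2 \in N by apply: inN pS _; rewrite eqxx.
rewrite pN andbT in hp.
rewrite leqNgt; apply/negP => hlt; apply: light; exists p; apply: leq_trans hlt _.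
rewrite leq_mul2l /= -[X in _ <= X](big_pred1_eq addn p w); apply: leq_sum_pred => q; rewrite inE => c.
apply: (connect_invariant (P := fun q => q == p) _ c) => // y z ayz /eqP yE; rewrite {y}yE in ayz.
case/and3P: ayz => /andP [a1 a2] _; rewrite !inE => hz.
have zX : z.1 \in X by have := cover _ _ pD (comp_closed pD a1) a1; rewrite (negbTE hp).
have zN : z.2 \in N by apply: inN pS _; rewrite a2 orbT.
by rewrite zX zN in hz.
Qed.

End ProductSeparators.

(** * Separators of a graph from separators of its double cover *)

Section DoubleCover.
Variable G : graph.
Local Notation H := (gprod G K2).

Lemma separable_double_cover k : separable H k -> separable G (2 * k).
Proof.
move=> sH w.
have [S0 [hS0 bS0]] := sH (fun p : gV H => w p.1).
pose S1 : {set gV G} := [set p.1 | p : gV H in S0].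
have cS1 : #|S1| <= k by apply: leq_trans (leq_imset_card _ _) _.
have [b1|nb1] := classic (balanced w S1); first by exists S1; split=> //; lia.
have [r [rS1 heavy]] : exists r, r \notin S1 /\
    \sum_u w u < 2 * \sum_(u in compin (~: S1) r) w u.
  apply: NNPP => nv; apply: nb1 => v hv; rewrite leqNgt.
  by apply/negP => hlt; apply: nv; exists v.
pose C := compin (~: S1) r.
pose A : {set gV H} := [set p : gV H | p.1 \notin S1].
pose c0 : gV H := (r, false).
pose C2 := compin A c0.
have sA : A \subset ~: S0.
  by apply/subsetP=> p; rewrite !inE; apply: contra => h; apply: imset_f.
have c0S : c0 \notin S0.
  by have /(subsetP sA) : c0 \in A; rewrite !inE.
(* The cover has twice the weight of [G], so half of it is the full weight of [G]. *)
have wC2 : \sum_(p in C2) w p.1 <= \sum_u w u.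
  have sumH : \sum_(p : gV H) w p.1 = 2 * \sum_u w u.
    rewrite -(pair_bigA _ (fun (u : gV G) (b : bool) => w u)) /= big_distrr /=.
    by apply: eq_bigr => u _; rewrite big_bool /=; lia.
  have := bS0 _ c0S; rewrite sumH.
  have := leq_sum_subset (fun p : gV H => w p.1) (compinS c0 sA); rewrite -/C2; lia.
pose flip (p : gV H) : gV H := (p.1, ~~ p.2).
have flipC p q : connect (edgein A) p q -> connect (edgein A) (flip p) (flip q).
  apply: connect_map => x y /and3P [/andP [a1 a2] hx hy]; apply: connect1.
  rewrite !inE in hx hy; rewrite /edgein /= !inE hx hy a1 /= !andbT.
  by move: a2; rewrite /=; case: (x.2); case: (y.2).
have lift u : u \in C -> exists b : bool, connect (edgein A) c0 (u, b).
  rewrite inE => c.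
  apply: (connect_invariant (P := fun u => exists b : bool, connect (edgein A) c0 (u, b)) _ c);
    last by exists false; exact: connect0.
  move=> x y /and3P [a]; rewrite !inE => hx hy [b hb]; exists (~~ b).
  apply: connect_trans hb (connect1 _); rewrite /edgein /= !inE /= hx hy a /= !andbT.
  by case: b.
(* If both lifts of [v] lie in [C2], then [c0] is connected to its flip, so [C2] contains both lifts
   of all of [C]. It then weighs at least twice the heavy set [C], against [wC2]. *)
have once v : v \in C -> ~ (forall b : bool, ((v, b) : gV H) \in C2).
  move=> vC both; suff : 2 * \sum_(u in C) w u <= \sum_(p in C2) w p.1 by rewrite /C; lia.
  have rr : connect (edgein A) c0 (flip c0).
    have := both true; rewrite inE => h1; apply: connect_trans h1 _.
    apply: connect_symmetric; first exact: edgein_sym.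
    by have := both false; rewrite inE => /flipC.
  have full u b : u \in C -> ((u, b) : gV H) \in C2.
    move=> /lift [b' hb']; rewrite inE; have := connect_trans rr (flipC _ _ hb').
    by rewrite /flip /=; move: hb'; case: b; case: b'.
  apply: (@leq_trans (\sum_(p : gV H | p.1 \in C) w p.1)).
    have -> : \sum_(p : gV H | p.1 \in C) w p.1 = \sum_(u in C) \sum_(b : bool) w u.
      by rewrite pair_big /=; apply: eq_bigl => p; rewrite andbT.
    rewrite big_distrr /=.
    by apply: leq_sum => u _; rewrite big_bool /=; lia.
  by apply: leq_sum_pred => -[u b] /=; apply: full.
(* Each vertex of [C] has exactly one lift in [C2]. The sheet of that lift is a proper 2-colouring
   of [C], and [u] sent to [(u, col u)] embeds [C] in the double cover. *)
pose col v : bool := ((v, true) : gV H) \in C2.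
have colC2 v : v \in C -> ((v, col v) : gV H) \in C2.
  move=> /lift [b hb]; case E: (col v); first exact: E.
  by move: hb E; rewrite /col !inE; case: b => [->|].
have colP u v : u \in C -> v \in C -> gadj u v -> col u != col v.
  move=> uC vC a.
  have uS : u \notin S1 by have := subsetP (@compin_sub _ (~: S1) r _) _ uC; rewrite !inE; apply.
  have vS : v \notin S1 by have := subsetP (@compin_sub _ (~: S1) r _) _ vC; rewrite !inE; apply.
  have h : ((v, ~~ col u) : gV H) \in C2.
    have := colC2 _ uC; rewrite !inE => c; apply: connect_trans c (connect1 _).
    by rewrite /edgein /= !inE /= uS vS a /= andbT; case: (col u).
  apply/negP => /eqP E; apply: (once v vC) => b; rewrite E in h.
  by have := colC2 _ vC; move: h; case: (col v); case: b.
(* The weight of [C] alone sits on the embedded copy and is separated a second time; the two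
   projected separators together give [2 * k]. *)
pose w'' (p : gV H) := if (p.1 \in C) && (p.2 == col p.1) then w p.1 else 0.
have [S3 [hS3 bS3]] := sH w''.
pose S4 : {set gV G} := [set p.1 | p : gV H in S3].
have cS4 : #|S4| <= k by apply: leq_trans (leq_imset_card _ _) _.
exists (S1 :|: S4); split.
  by have : #|S1 :|: S4| <= #|S1| + #|S4|; [apply: leq_card_setU|lia].
move=> v; rewrite inE negb_or => /andP [vS1 vS4].
have sZ : compin (~: (S1 :|: S4)) v \subset compin (~: S1) v.
  by apply: compinS; rewrite setCS subsetUl.
(* A component off the heavy set [C] is disjoint from it and so carries less than half. *)
have [vC|vC] := boolP (v \in C); last first.
  have dis : [disjoint C & compin (~: (S1 :|: S4)) v].
    rewrite disjoint_sym disjoints_subset; apply/subsetP=> u /(subsetP sZ).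
    rewrite !inE => h; apply: contra vC => h'; rewrite inE; apply: connect_trans h' _.
    by apply: connect_symmetric h; exact: edgein_sym.
  by have := sum_disjoint w dis; rewrite /C; lia.
pose g u : gV H := (u, col u).
have gvS : g v \notin S3 by apply: contra vS4 => h; apply/imsetP; exists (g v).
have tot : \sum_p w'' p <= \sum_u w u.
  rewrite -(pair_bigA _ (fun (u : gV G) (b : bool) => w'' (u, b))) /=.
  apply: leq_sum => u _; rewrite big_bool /w'' /=.
  by case: (u \in C); case: (col u) => /=; lia.
have ZC u : u \in compin (~: (S1 :|: S4)) v -> u \in C.
  by move=> /(subsetP sZ); move: vC; rewrite /C !inE; apply: connect_trans.
have Zg u : u \in compin (~: (S1 :|: S4)) v -> g u \in compin (~: S3) (g v).
  move=> uZ; have := uZ; rewrite inE => c.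
  have [] // : g u \in compin (~: S3) (g v) /\ u \in compin (~: (S1 :|: S4)) v.
  apply: (connect_invariant (P := fun u => g u \in compin (~: S3) (g v) /\
             u \in compin (~: (S1 :|: S4)) v) _ c); last by rewrite !inE !connect0.
  move=> x y exy [hx xZ].
  have yZ : y \in compin (~: (S1 :|: S4)) v.
    by rewrite !inE in xZ *; apply: connect_trans xZ (connect1 exy).
  split=> //; move: hx; rewrite !inE => hx; apply: connect_trans hx (connect1 _).
  case/and3P: exy => a; rewrite !inE !negb_or => /andP [_ x4] /andP [_ y4].
  rewrite /edgein /= a (colP _ _ (ZC _ xZ) (ZC _ yZ) a) !inE /=; apply/andP; split.
    by apply: contra x4 => h; apply/imsetP; exists (g x).
  by apply: contra y4 => h; apply/imsetP; exists (g y).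
apply: leq_trans _ tot; apply: leq_trans _ (bS3 _ gvS); rewrite leq_mul2l /=.
have -> : \sum_(u in compin (~: (S1 :|: S4)) v) w u =
          \sum_(p in g @: compin (~: (S1 :|: S4)) v) w'' p.
  rewrite big_imset /=; last by move=> x y _ _ [].
  by apply: eq_bigr => u /ZC uC; rewrite /w'' /= uC eqxx.
by apply: leq_sum_subset; apply/subsetP=> _ /imsetP [u uZ ->]; apply: Zg.
Qed.

End DoubleCover.

(** * Crossing families, long paths, stars and spiders *)

Definition has_path (G : graph) n : Prop :=
  exists s : seq (gV G), [/\ n <= size s, uniq s & sorted (@gadj G) s].

Definition has_star (G : graph) n : Prop :=
  exists c : gV G, n <= #|[set u | gadj c u]|.

(* [c] may coincide with an end of a leg, and a middle vertex with an end of
   another leg: the crossing argument in a product tolerates this. *)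
Definition has_spider (G : graph) n : Prop :=
  exists (c : gV G) (s : seq (gV G * gV G)),
    [/\ n <= size s, uniq (unzip1 s), uniq (unzip2 s)
      & forall q, q \in s -> gadj c q.1 && gadj q.1 q.2].

(** Sending a vertex of [S] to the index of the unique set containing it reaches every set that is
    hit. *)
Lemma card_hit_leq (T : finType) n (F : 'I_n -> {set T}) (S : {set T}) :
  (forall i i' x, x \in F i -> x \in F i' -> i = i') ->
  #|[set i | ~~ [disjoint F i & S]]| <= #|S|.
Proof.
move=> dF; pose g x := [pick i | x \in F i].
apply: leq_trans (leq_imset_card g S).
have injS : injective (@Some 'I_n) by move=> i j [].
rewrite -(card_imset _ injS); apply: subset_leq_card.
apply/subsetP=> _ /imsetP [i hi ->]; move: hi; rewrite inE.
case/pred0Pn => x /andP [/= xF xS]; apply/imsetP; exists x => //.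
rewrite /g; case: pickP => [i' hi'|/(_ i)]; last by rewrite xF.
by rewrite (dF _ _ _ xF hi').
Qed.

(* Fewer than [n / 2] vertices miss a column and more than half of the rows,
   and a surviving column links all surviving rows. *)
Lemma crossing_bound (G : graph) k n (R C : 'I_n -> {set gV G}) (r c : 'I_n -> gV G) :
  separable G k ->
  (forall i, r i \in R i) -> (forall j, c j \in C j) ->
  (forall i i' x, x \in R i -> x \in R i' -> i = i') ->
  (forall j j' x, x \in C j -> x \in C j' -> j = j') ->
  (forall i j (A : {set gV G}), R i \subset A -> C j \subset A ->
     connect (edgein A) (c j) (r i)) ->
  n <= 2 * k.
Proof.
move=> sG rR cC dR dC con; rewrite leqNgt; apply/negP => hn.
have injr : injective r by move=> i i' h; apply: (dR i i' (r i)); rewrite ?rR // h rR.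
pose W := [set r i | i : 'I_n].
have cW : #|W| = n by rewrite card_imset // card_ord.
have [S [hS bS]] := sG (fun u => u \in W : nat).
pose bad (F : 'I_n -> {set gV G}) := [set i | ~~ [disjoint F i & S]].
have [j hj] : exists j, j \notin bad C.
  apply/existsP; rewrite -negb_forall; apply/negP => /forallP h.
  have : #|bad C| <= #|S| by apply: card_hit_leq.
  have -> : bad C = setT by apply/setP=> j; rewrite h inE.
  by rewrite cardsT card_ord; lia.
have sub F i : i \notin bad F -> F i \subset ~: S by rewrite inE negbK disjoints_subset.
have cjS : c j \notin S by have := subsetP (sub _ _ hj) _ (cC j); rewrite inE.
have := bS _ cjS; rewrite sum_indicator.
have -> : \sum_u (u \in W : nat) = n.
  by rewrite -cW -[in RHS](setTI W) -sum_indicator; apply: eq_bigl => u; rewrite inE.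
have : #|r @: ~: bad R| <= #|compin (~: S) (c j) :&: W|.
  apply: subset_leq_card; apply/subsetP=> _ /imsetP [i hi ->]; rewrite in_setC in hi.
  by rewrite inE imset_f // andbT inE; apply: con; apply: sub.
rewrite card_imset //; have := cardsC (bad R); rewrite card_ord.
have : #|bad R| <= #|S| by apply: card_hit_leq.
lia.
Qed.

Lemma connect_walk (G : graph) (A : {set gV G}) (f : nat -> gV G) N :
  (forall a, a < N -> f a \in A) -> (forall a, a.+1 < N -> gadj (f a) (f a.+1)) ->
  forall a, a < N -> connect (edgein A) (f 0) (f a).
Proof.
move=> fA adj; elim=> [|a IH] ha; first exact: connect0.
apply: connect_trans (IH (ltnW ha)) (connect1 _).
by rewrite /edgein /= adj // !fA // ltnW.
Qed.

Lemma has_path_fun (G : graph) n : 0 < n -> has_path G n ->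
  exists p : nat -> gV G, (forall a b, a < n -> b < n -> p a = p b -> a = b) /\
    (forall a, a.+1 < n -> gadj (p a) (p a.+1)).
Proof.
move=> n0 [[|x0 s'] [hn us ss]]; first by move: hn; rewrite leqNgt n0.
exists (nth x0 (x0 :: s')); split.
  move=> a b ha hb /eqP; rewrite nth_uniq //; [by move/eqP|exact: leq_trans ha hn|].
  exact: leq_trans hb hn.
by move=> a ha; apply: (sortedP x0 ss); apply: leq_trans ha hn.
Qed.

(** Row [i] walks along [p] while its second coordinate zigzags on the edge from [q i.*2] to
    [q i.*2.+1]; columns exchange the roles. Row [i] and column [j] meet at [(p j.*2, q i.*2)]. *)
Lemma path_path_bound G1 G2 k n :
  separable (gprod G1 G2) k -> has_path G1 n.*2 -> has_path G2 n.*2 -> n <= 2 * k.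
Proof.
case: n => // m; set n := m.+1 => sG h1 h2.
have n0 : 0 < n.*2 by [].
have [p [injp adjp]] := has_path_fun n0 h1; have [q [injq adjq]] := has_path_fun n0 h2.
pose row i a : gV (gprod G1 G2) := (p a, q (odd a + i.*2)).
pose colm j b : gV (gprod G1 G2) := (p (odd b + j.*2), q b).
have small (b : bool) (i : 'I_n) : b + i.*2 < n.*2.
  by have := ltn_ord i; have := leq_b1 b; lia.
have dbl (i : 'I_n) : i.*2 < n.*2 by exact: (small false i).
have zig (G : graph) (f : nat -> gV G) (i : 'I_n) a :
    (forall a, a.+1 < n.*2 -> gadj (f a) (f a.+1)) ->
    gadj (f (odd a + i.*2)) (f (odd a.+1 + i.*2)).
  move=> adj; rewrite oddS; case: (odd a); last exact: adj (small true i).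
  by rewrite gsym; apply: adj (small true i).
apply: (crossing_bound sG (R := fun i => [set row i a | a : 'I_n.*2])
         (C := fun j => [set colm j b | b : 'I_n.*2])
         (r := fun i => row i 0) (c := fun j => colm j 0)).
- by move=> i; apply/imsetP; exists (Ordinal n0).
- by move=> j; apply/imsetP; exists (Ordinal n0).
- move=> i i' x /imsetP [a _ ->] /imsetP [a' _ [ep eq]].
  have ea := injp _ _ (ltn_ord a) (ltn_ord a') ep; rewrite ea in eq.
  by apply: val_inj => /=; have := injq _ _ (small _ i) (small _ i') eq; lia.
- move=> j j' x /imsetP [b _ ->] /imsetP [b' _ [ep eq]].
  have eb := injq _ _ (ltn_ord b) (ltn_ord b') eq; rewrite eb in ep.
  by apply: val_inj => /=; have := injp _ _ (small _ j) (small _ j') ep; lia.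
move=> i j A /subsetP sR /subsetP sC.
have rowA a : a < n.*2 -> row i a \in A.
  by move=> ha; apply: sR; apply/imsetP; exists (Ordinal ha).
have colA b : b < n.*2 -> colm j b \in A.
  by move=> hb; apply: sC; apply/imsetP; exists (Ordinal hb).
have cross : colm j i.*2 = row i j.*2 by rewrite /colm /row !odd_double.
have rowadj a : a.+1 < n.*2 -> gadj (row i a) (row i a.+1).
  by move=> ha; apply/andP; split; [exact: adjp|exact: zig].
have coladj b : b.+1 < n.*2 -> gadj (colm j b) (colm j b.+1).
  by move=> hb; apply/andP; split; [exact: zig|exact: adjq].
apply: connect_trans (connect_walk colA coladj (dbl i)) _; rewrite cross.
apply: connect_symmetric; first exact: edgein_sym.
exact: connect_walk rowA rowadj _ (dbl j).
Qed.

(** Row [i] walks along [p] while its second coordinate alternates between the two vertices of leg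
    [i]. Column [j] is the single vertex [(p j.*2.+1, c)], adjacent to each row at position [j.*2],
    where the row is at the middle of its leg. *)
Lemma path_spider_bound G1 G2 k n :
  separable (gprod G1 G2) k -> has_path G1 n.*2.+1 -> has_spider G2 n -> n <= 2 * k.
Proof.
move=> sG h1 [c [s [hn u1 u2 hs]]].
have n0 : 0 < n.*2.+1 by [].
have [p [injp adjp]] := has_path_fun n0 h1.
pose leg j := nth (c, c) s j.
have legP (j : 'I_n) : gadj c (leg j).1 && gadj (leg j).1 (leg j).2.
  by apply: hs; apply: mem_nth; apply: leq_trans hn.
have lt_size (j : 'I_n) : j < size s by apply: leq_trans hn.
have inj1 (i j : 'I_n) : (leg i).1 = (leg j).1 -> i = j.
  rewrite /leg -!(nth_map _ c fst) // => /eqP; rewrite nth_uniq ?size_map //.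
  by move/eqP/val_inj.
have inj2 (i j : 'I_n) : (leg i).2 = (leg j).2 -> i = j.
  rewrite /leg -!(nth_map _ c snd) // => /eqP; rewrite nth_uniq ?size_map //.
  by move/eqP/val_inj.
pose row j a : gV (gprod G1 G2) := (p a, if odd a then (leg j).2 else (leg j).1).
pose pt (i : 'I_n) : gV (gprod G1 G2) := (p i.*2.+1, c).
have small (i : 'I_n) : i.*2.+1 < n.*2.+1 by have := ltn_ord i; lia.
apply: (crossing_bound sG (R := fun i => [set row i a | a : 'I_n.*2.+1])
         (C := fun j => [set pt j]) (r := fun i => row i 0) (c := pt)).
- by move=> i; apply/imsetP; exists (Ordinal n0).
- by move=> j; rewrite inE.
- move=> i i' x /imsetP [a _ ->] /imsetP [a' _ [ep]].
  rewrite (injp _ _ (ltn_ord a) (ltn_ord a') ep).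
  by case: (odd a'); [exact: inj2|exact: inj1].
- move=> j j' x; rewrite !inE => /eqP -> /eqP [ep].
  by apply: val_inj => /=; have := injp _ _ (small j) (small j') ep; lia.
move=> i j A /subsetP sR; rewrite sub1set => jA.
have rowA a : a < n.*2.+1 -> row i a \in A.
  by move=> ha; apply: sR; apply/imsetP; exists (Ordinal ha).
case/andP: (legP i) => ac al.
have rowadj a : a.+1 < n.*2.+1 -> gadj (row i a) (row i a.+1).
  move=> ha; apply/andP; split; [exact: adjp|rewrite /row oddS /=].
  by case: (odd a) => //=; rewrite gsym.
apply: (@connect_trans _ _ (row i j.*2)).
  apply: connect1; rewrite /edgein /= jA rowA ?(ltnW (small j)) // /row odd_double /= ac.
  by rewrite gsym adjp.
apply: connect_symmetric; first exact: edgein_sym.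
exact: connect_walk rowA rowadj _ (ltnW (small j)).
Qed.

Lemma has_star_fun (G : graph) n : has_star G n ->
  exists c (l : 'I_n -> gV G), injective l /\ forall i, gadj c (l i).
Proof.
move=> [c hc]; exists c, (fun i => enum_val (widen_ord hc i)); split.
  by move=> i j /enum_val_inj [] /val_inj.
by move=> i; have := enum_valP (widen_ord hc i); rewrite inE.
Qed.

(** Rows and columns are single vertices, centre paired with leaf and leaf with centre; together
    they span a complete bipartite graph. *)
Lemma star_star_bound G1 G2 k n :
  separable (gprod G1 G2) k -> has_star G1 n -> has_star G2 n -> n <= 2 * k.
Proof.
move=> sG /has_star_fun [c1 [l1 [inj1 h1]]] /has_star_fun [c2 [l2 [inj2 h2]]].
pose r i : gV (gprod G1 G2) := (c1, l2 i); pose c i : gV (gprod G1 G2) := (l1 i, c2).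
apply: (crossing_bound sG (R := fun i => [set r i]) (C := fun i => [set c i]) (r := r) (c := c)).
- by move=> i; rewrite inE.
- by move=> i; rewrite inE.
- by move=> i i' x; rewrite !inE => /eqP -> /eqP [/inj2].
- by move=> i i' x; rewrite !inE => /eqP -> /eqP [/inj1].
move=> i j A; rewrite !sub1set => hr hc; apply: connect1.
by rewrite /edgein /= hr hc gsym h1 h2.
Qed.

(** * Components without long paths and large stars or spiders *)

Section Spreading.
Variables (G : graph) (H : gV G -> {set gV G}) (h : nat) (v : gV G).
Hypothesis selfH : forall c, c \in H c.
Hypothesis cardH : forall c, #|H c| <= h.

(** A substitute for the ball of radius [i] around [v], with the bounded sets [H c] in place of
    closed neighbourhoods. *)
Fixpoint spread i : {set gV G} :=
  if i is j.+1 then \bigcup_(c in spread j) H c else [set v].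

Lemma card_spread i : #|spread i| <= h ^ i.
Proof.
elim: i => [|i IH] /=; first by rewrite cards1.
rewrite expnSr; apply: leq_trans (card_bigcup_leq (fun c _ => cardH c)) _.
by rewrite leq_mul2r IH orbT.
Qed.

Lemma spreadS c z i : c \in spread i -> z \in H c -> z \in spread i.+1.
Proof. by move=> hc hz; apply/bigcupP; exists c. Qed.

Lemma spread_mono i j : i <= j -> spread i \subset spread j.
Proof.
move=> /subnK <-; elim: (j - i) => [|d IH] //.
by apply: subset_trans IH _; apply/subsetP=> c hc; apply: spreadS hc (selfH c).
Qed.

(** Induction along the walk: of the last two vertices one is already reached. If it is the earlier
    one, [cover] at that vertex reaches an end of the next edge. *)
Lemma spread_edge p z :
  (forall c m z, gadj c m -> gadj m z -> (m \in H c) || (z \in H c)) ->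
  path (@gadj G) v p -> gadj (last v p) z ->
  (last v p \in spread (size p)) || (z \in spread (size p)).
Proof.
move=> cover; elim/last_ind: p z => [|p y IH] z /=; first by rewrite inE eqxx.
rewrite rcons_path last_rcons size_rcons => /andP [pp ay] az.
case/orP: (IH _ pp ay) => hx.
  by case/orP: (cover _ _ _ ay az) => /(spreadS hx) ->; rewrite ?orbT.
by rewrite (subsetP (spread_mono (leqnSn _)) _ hx).
Qed.

Lemma spread_vertex p :
  (forall c m, gadj c m -> m \in H c) -> path (@gadj G) v p -> last v p \in spread (size p).
Proof.
move=> nbr; elim/last_ind: p => [|p y IH] /=; first by rewrite inE.
rewrite rcons_path last_rcons size_rcons => /andP [pp ay].
exact: spreadS (IH pp) (nbr _ _ ay).
Qed.

End Spreading.

Lemma comp_short_path (G : graph) n (v u : gV G) :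
  ~ has_path G n -> u \in comp v ->
  exists p, [/\ path (@gadj G) v p, last v p = u & size p <= n].
Proof.
move=> nP; rewrite inE => /connectP [p0 pp0 ->].
case/shortenP: pp0 => p pp up _; exists p; split=> //.
rewrite leqNgt; apply/negP => hn; apply: nP; exists (v :: p); split=> //=.
exact: leqW (ltnW hn).
Qed.

Lemma vc_in_leq (G : graph) (C S : {set gV G}) : vertex_cover_in C S -> vc_in C <= #|S|.
Proof.
move=> cS; rewrite /vc_in; elim: (index_enum _) (mem_index_enum S) => // S' s IH.
rewrite inE big_cons => /orP [/eqP <-|/IH hs]; first by rewrite cS geq_minl.
by case: ifP => // _; apply: leq_trans (geq_minr _ _) hs.
Qed.

(** Without long paths a component lies within distance [n] of any of its vertices, and closed
    neighbourhoods have at most [d.+1] vertices. *)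
Lemma max_comp_size_leq (G : graph) n d :
  ~ has_path G n -> ~ has_star G d -> max_comp_size G <= d.+1 ^ n.
Proof.
move=> nP nS; apply/bigmax_leqP => v _.
pose H (c : gV G) := c |: [set u | gadj c u].
have selfH c : c \in H c by exact: setU11.
have cardH c : #|H c| <= d.+1.
  rewrite cardsU1 -add1n leq_add ?leq_b1 // leqNgt; apply/negP => h.
  by apply: nS; exists c; exact: ltnW.
apply: leq_trans (card_spread v cardH n); apply: subset_leq_card.
apply/subsetP=> u /(comp_short_path nP) [p [pp <- hp]].
apply: subsetP (spread_mono v selfH hp) _ _; apply: spread_vertex pp => c m a.
by rewrite !inE a orbT.
Qed.

(* A maximal family of legs at [c] meets every edge incident with a neighbour of [c]. *)
Lemma spider_or_cover (G : graph) (c : gV G) d :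
  ~ has_spider G d -> exists H : {set gV G}, [/\ c \in H, #|H| <= (2 * d).+1 &
    forall m z, gadj c m -> gadj m z -> (m \in H) || (z \in H)].
Proof.
move=> nS.
suff grow n : (exists H : {set gV G}, [/\ c \in H, #|H| <= (2 * n).+1 &
    forall m z, gadj c m -> gadj m z -> (m \in H) || (z \in H)]) \/
    exists s : seq (gV G * gV G), [/\ size s = n, uniq (unzip1 s), uniq (unzip2 s)
      & forall q, q \in s -> gadj c q.1 && gadj q.1 q.2].
  case: (grow d) => // -[s [hs u1 u2 h]]; case: nS.
  by exists c, s; split=> //; rewrite hs.
elim: n => [|n [[H [h1 h2 h3]]|[s [hs u1 u2 hl]]]].
- by right; exists [::].
- by left; exists H; split=> //; lia.
have [[[m z] [am az hm hz]]|max] := classic (exists q : gV G * gV G,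
    [/\ gadj c q.1, gadj q.1 q.2, q.1 \notin unzip1 s & q.2 \notin unzip2 s]).
  right; exists ((m, z) :: s); split; rewrite /= ?hs ?hm ?hz //.
  by move=> q; rewrite inE => /orP [/eqP ->|/hl //]; rewrite am az.
left; exists [set x in c :: unzip1 s ++ unzip2 s]; split.
- by rewrite !inE eqxx.
- rewrite cardsE; apply: leq_trans (card_size _) _.
  by rewrite /= size_cat !size_map hs; lia.
move=> m z am az; rewrite !inE !mem_cat.
case hm: (m \in unzip1 s); first by rewrite orbT.
case hz: (z \in unzip2 s); first by rewrite !orbT.
by case: max; exists (m, z); rewrite /= hm hz.
Qed.

(** The sets of [spider_or_cover] are spread [n] times from [v]. For an edge of the component, a
    short path to one end followed by the edge itself shows that the spread contains one of its
    ends. *)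
Lemma max_comp_vc_leq (G : graph) n d :
  ~ has_path G n -> ~ has_spider G d -> max_comp_vc G <= (2 * d).+1 ^ n.
Proof.
move=> nP nS; apply/bigmax_leqP => v _.
have [H hH] := fin_all_exists (fun c : gV G => spider_or_cover c nS).
have selfH c : c \in H c by case: (hH c).
have cardH c : #|H c| <= (2 * d).+1 by case: (hH c).
apply: leq_trans (card_spread v cardH n).
apply: leq_trans (subset_leq_card (subsetIl (spread H v n) (comp v))).
apply: vc_in_leq; rewrite /vertex_cover_in subsetIr /=.
apply/forallP=> x; apply/forallP=> y; apply/implyP; rewrite !in_setD !in_setI.
case/andP=> /andP [xS xC] /andP [yS yC]; rewrite xC yC !andbT in xS yS.
apply/negP => axy; have [p [pp lp hp]] := comp_short_path nP xC.
have mono := subsetP (spread_mono v selfH hp).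
have : (last v p \in spread H v (size p)) || (y \in spread H v (size p)).
  by apply: (spread_edge selfH) => //; [move=> c; case: (hH c)|rewrite lp].
by rewrite lp => /orP [/mono|/mono] h; [rewrite h in xS|rewrite h in yS].
Qed.

(** * Unbounded parameters and the characterization *)

Definition unbounded_in (C : graph -> Prop) (P : graph -> nat -> Prop) : Prop :=
  forall n, exists G, C G /\ P G n.

Lemma not_unbounded_in C P :
  ~ unbounded_in C P -> exists n, forall G, C G -> ~ P G n.
Proof.
move=> /not_all_ex_not [n hn]; exists n => G hG hP; apply: hn; by exists G.
Qed.

Lemma unbounded_maxdeg C : ~ bounded maxdeg C -> unbounded_in C has_star.
Proof.
move=> h; apply: NNPP => /not_unbounded_in [n hn]; apply: h; exists n => G hG.
apply/bigmax_leqP => v _; rewrite leqNgt; apply/negP => hv; apply: (hn G hG).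
by exists v; exact: ltnW.
Qed.

Lemma unbounded_max_comp_size C :
  ~ bounded max_comp_size C -> unbounded_in C has_path \/ unbounded_in C has_star.
Proof.
move=> h; apply: NNPP => /not_or_and [/not_unbounded_in [n hn] /not_unbounded_in [d hd]].
by apply: h; exists (d.+1 ^ n) => G hG; apply: max_comp_size_leq; [apply: hn|apply: hd].
Qed.

Lemma unbounded_max_comp_vc C :
  ~ bounded max_comp_vc C -> unbounded_in C has_path \/ unbounded_in C has_spider.
Proof.
move=> h; apply: NNPP => /not_or_and [/not_unbounded_in [n hn] /not_unbounded_in [d hd]].
by apply: h; exists ((2 * d).+1 ^ n) => G hG; apply: max_comp_vc_leq; [apply: hn|apply: hd].
Qed.

Lemma has_spider_star G n : has_spider G n -> has_star G n.
Proof.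
move=> [c [s [hn u1 _ hs]]]; exists c; apply: leq_trans hn _.
rewrite -(size_map fst) -(card_uniqP u1); apply: subset_leq_card; apply/subsetP=> _ /mapP [q hq ->].
by rewrite inE; case/andP: (hs _ hq).
Qed.

Lemma unbounded_spider_star C : unbounded_in C has_spider -> unbounded_in C has_star.
Proof. by move=> h n; have [G [hG /has_spider_star hS]] := h n; exists G. Qed.

(** Only products with [K2] are used, that is, the double covers of the members of [C1]. *)
Lemma separable_class_tw C1 C2 k :
  C2 K2 -> (forall G, prod_class C1 C2 G -> separable G k) -> bounded tw C1.
Proof.
move=> k2 h; apply/bounded_tw_separable; exists (2 * k) => G hG.
apply: separable_double_cover; apply: h; exists G, K2; split=> //; split=> //.
by exists id; split=> //; exists id.
Qed.

Lemma prod_class_bounded C1 C2 :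
  bounded tw C2 ->
  (bounded max_comp_size C1 \/ bounded max_comp_vc C1 /\ bounded maxdeg C2) ->
  exists k, forall G1 G2, C1 G1 -> C2 G2 -> separable (gprod G1 G2) k.
Proof.
move=> /bounded_tw_separable [k hk] [[m hm]|[[t ht] [d hd]]].
  by exists (m * k) => G1 G2 /hm h1 /hk; apply: separable_prod_comp_size.
exists (t * (k * d.+1)).+1 => G1 G2 /ht h1 h2.
by apply: separable_prod_comp_vc; [|apply: hd|apply: hk].
Qed.

Theorem mainTheorem19 (C1 C2 : graph -> Prop) :
  graph_class C1 -> graph_class C2 ->
  monotone C1 -> monotone C2 ->
  C1 K2 -> C2 K2 ->
  (bounded tw (prod_class C1 C2) <->
   (bounded tw C1 /\ bounded tw C2 /\
    ((bounded max_comp_size C1 \/ bounded max_comp_size C2) \/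
     (bounded max_comp_vc C1 /\ bounded maxdeg C2) \/
     (bounded max_comp_vc C2 /\ bounded maxdeg C1)))).
Proof.
move=> _ _ _ _ k1 k2; split; last first.
  move=> [tw1 [tw2 cases]]; apply/bounded_tw_separable.
  have [k hk] : exists k, forall G1 G2, C1 G1 -> C2 G2 -> separable (gprod G1 G2) k.
    have sym : (exists k, forall G2 G1, C2 G2 -> C1 G1 -> separable (gprod G2 G1) k) ->
        exists k, forall G1 G2, C1 G1 -> C2 G2 -> separable (gprod G1 G2) k.
      by move=> [k hk]; exists k => G1 G2 h1 h2; apply/separable_gprodC/hk.
    case: cases => [[b|b]|[b|b]].
    - by apply: prod_class_bounded => //; left.
    - by apply/sym/prod_class_bounded => //; left.
    - by apply: prod_class_bounded => //; right.
    - by apply/sym/prod_class_bounded => //; right.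
  exists k => G [G1 [G2 [h1 [h2 [f [bf hf]]]]]]; apply: separable_subgraph (hk _ _ h1 h2).
  by exists f; split; [exact: bij_inj|move=> x y; rewrite hf].
move=> /bounded_tw_separable [k hk].
have sep G1 G2 : C1 G1 -> C2 G2 -> separable (gprod G1 G2) k.
  by move=> h1 h2; apply: hk; exists G1, G2; do 2!split=> //; exists id; split=> //; exists id.
split; first exact: separable_class_tw k2 hk.
split.
  apply: (@separable_class_tw C2 C1 k) => // G [G2 [G1 [h2 [h1 [f [bf hf]]]]]].
  apply: separable_subgraph (separable_gprodC (sep _ _ h1 h2)).
  by exists f; split; [exact: bij_inj|move=> x y; rewrite hf].
(* Each of the four exclusions takes [n] equal to [(2 * k).+1], just above the bound [2 * k] of the
   crossing lemmas. *)
have PP : unbounded_in C1 has_path -> unbounded_in C2 has_path -> False.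
  move=> h1 h2; have [G1 [c1 p1]] := h1 (2 * k).+1.*2; have [G2 [c2 p2]] := h2 (2 * k).+1.*2.
  by have := path_path_bound (sep _ _ c1 c2) p1 p2; rewrite ltnn.
have SS : unbounded_in C1 has_star -> unbounded_in C2 has_star -> False.
  move=> h1 h2; have [G1 [c1 p1]] := h1 (2 * k).+1; have [G2 [c2 p2]] := h2 (2 * k).+1.
  by have := star_star_bound (sep _ _ c1 c2) p1 p2; rewrite ltnn.
have PS : unbounded_in C1 has_path -> unbounded_in C2 has_spider -> False.
  move=> h1 h2; have [G1 [c1 p1]] := h1 (2 * k).+1.*2.+1; have [G2 [c2 p2]] := h2 (2 * k).+1.
  by have := path_spider_bound (sep _ _ c1 c2) p1 p2; rewrite ltnn.
have SP : unbounded_in C1 has_spider -> unbounded_in C2 has_path -> False.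
  move=> h1 h2; have [G1 [c1 p1]] := h1 (2 * k).+1; have [G2 [c2 p2]] := h2 (2 * k).+1.*2.+1.
  by have := path_spider_bound (separable_gprodC (sep _ _ c1 c2)) p2 p1; rewrite ltnn.
have d1 := @unbounded_maxdeg C1; have d2 := @unbounded_maxdeg C2.
have v1 := @unbounded_max_comp_size C1; have v2 := @unbounded_max_comp_size C2.
have t1 := @unbounded_max_comp_vc C1; have t2 := @unbounded_max_comp_vc C2.
have s1 := @unbounded_spider_star C1; have s2 := @unbounded_spider_star C2.
(* Both component sizes are unbounded, so by [PP] and [SS] one class has long paths and the other
   large stars; say [C1] has the paths. Then [SS] bounds the degree in [C1], so by [neg] the cover
   numbers in [C2] are unbounded. This yields long paths or large spiders in [C2], against [PP] or
   [PS]. The other case is symmetric, with [SP]. *)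
apply: NNPP => neg.
have [? ?] : ~ bounded max_comp_size C1 /\ ~ bounded max_comp_size C2 by tauto.
have [?|?] := classic (bounded max_comp_vc C1);
have [?|?] := classic (bounded max_comp_vc C2);
have [?|?] := classic (bounded maxdeg C1);
have [?|?] := classic (bounded maxdeg C2); tauto.
Qed.
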